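(* Let $X$ be a locally path connected topological space. The monoid map $$\exists:\ \mathrm{Exp}_{\mathrm M}(X)\longrightarrow\bigoplus_{\pi_0(X)}\mathbf I_2$$ sending a finite subset $S\subset X$ to the family $\{\exists_i\}_{i\in\pi_0(X)}$, with $\exists_i=0$ if and only if no element of $S$ belongs to the connected component $X_i\subset X$, is continuous and a weak homotopy equivalence. Moreover, if $X$ is also separated (Hausdorff), the induced continuous map $\exists:\mathrm{Exp}_{\mathrm T}(X)\to\bigoplus_{\pi_0(X)}\mathbf I_2$ (given by the same formula) is also a weak homotopy equivalence.
   Context: $\mathbf I_2=(\{0,1\},\vee)$ is the commutative idempotent monoid with two elements, with the discrete topology. $\bigoplus_{\pi_0(X)}\mathbf I_2$ is the monoid of families in $\mathbf I_2$ indexed by $\pi_0(X)$ with only finitely many non-zero entries, with the discrete topology. $\mathrm{Exp}(X)$ is the set of finite subsets of $X$ (including the empty one), a monoid under union. Topological exponential $\mathrm{Exp}_{\mathrm T}(X)$: the set $\mathrm{Exp}(X)$ with the finest topology making the maps $X^n\to\mathrm{Exp}(X)$, $(x_1,\dots,x_n)\mapsto\{x_1,\dots,x_n\}$, continuous for all $n\ge0$. Metric exponential $\mathrm{Exp}_{\mathrm M}(X)$: the set $\mathrm{Exp}(X)$ with the coarsest topology including all sets $[U_i]_{i\in I}:=\{S\in\mathrm{Exp}(X)\mid S\cap U_i\ne\emptyset\ \text{for all } i\in I\}$, for every finite set $I$ of open subsets $U_i\subset X$. The identity $\mathrm{Exp}_{\mathrm T}(X)\to\mathrm{Exp}_{\mathrm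 M}(X)$ is continuous.
   Formalization: The topology of Exp_M(X) is generated by the sets of S that meet every U_i and are also contained in the union of the U_i; without this covering condition the only neighborhood of the empty subset is all of Exp(X), and ∃ is not continuous for any non-empty X. *)

(* Defs.v *)
From HB Require Import structures.
From mathcomp Require Import all_boot all_order all_algebra generic_quotient.
From mathcomp Require Import finmap ring lra.
From mathcomp Require Import all_classical all_reals topology normedtype.
From mathcomp Require Import homotopy.

Set Implicit Arguments.
Unset Strict Implicit.
Unset Printing Implicit Defensive.

Import Order.TTheory GRing.Theory Num.Theory.
Import numFieldNormedType.Exports.

Local Open Scope classical_set_scope.
Local Open Scope ring_scope.
Local Open Scope quotient_scope.

Definition unitI (R : realType) : Type := set_type `[0 : R, 1]%classic.

Lemma pair_continuous (T A B : topologicalType) (f : T -> A) (g : T -> B) :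
  continuous f -> continuous g -> continuous (fun t => (f t, g t)).
Proof.
move=> cf cg t; apply: (@cvg_pair _ _ _ (nbhs t) (nbhs (f t)) (nbhs (g t))).
  exact: cf.
exact: cg.
Qed.

Lemma comp_fst_continuous (A A' B X : topologicalType) (u : A -> A')
    (H : A' * B -> X) :
  continuous u -> continuous H -> continuous (fun ab => H (u ab.1, ab.2)).
Proof.
move=> cu cH ab.
apply: (@continuous_comp _ _ _ (fun ab : A * B => (u ab.1, ab.2)));
  last exact: cH.
apply: pair_continuous => {}ab; last exact: cvg_snd.
by apply: (@continuous_comp _ _ _ fst); [exact: cvg_fst|exact: cu].
Qed.

Section UnitInterval.
Context {R : realType}.

Lemma unitI_subproof (x : R) : 0 <= x <= 1 -> x \in `[0 : R, 1]%classic.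
Proof. by move=> x01; rewrite inE /= in_itv. Qed.

Definition mkI (x : R) (x01 : 0 <= x <= 1) : unitI R := SigSub (unitI_subproof x01).

Definition Ival (s : unitI R) : R := \val s.

Lemma Ival_inj : injective Ival. Proof. exact: val_inj. Qed.

Lemma Ival_itv (s : unitI R) : 0 <= Ival s <= 1.
Proof. by have := valP s; rewrite inE /= in_itv. Qed.

Lemma I0_subproof : 0 <= (0 : R) <= 1. Proof. by rewrite lexx ler01. Qed.
Lemma I1_subproof : 0 <= (1 : R) <= 1. Proof. by rewrite lexx ler01. Qed.

HB.instance Definition _ := Topological.copy (unitI R) (set_type `[0 : R, 1]%classic).

Lemma I01_neq : mkI I0_subproof != mkI I1_subproof.
Proof. by rewrite -(inj_eq Ival_inj) /= eq_sym oner_neq0. Qed.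

HB.instance Definition _ := isBiPointed.Build (unitI R) I01_neq.

Lemma Ival0 : Ival zero = 0. Proof. by []. Qed.
Lemma Ival1 : Ival one = 1. Proof. by []. Qed.

Lemma clamp_subproof (x : R) : 0 <= Num.max 0 (Num.min 1 x) <= 1.
Proof. by rewrite le_max lexx ge_max ler01 ge_min lexx. Qed.

Definition clamp (x : R) : unitI R := mkI (clamp_subproof x).

Lemma Ival_continuous : continuous Ival.
Proof. exact: initial_continuous. Qed.

Lemma unitI_continuous (T : topologicalType) (f : T -> unitI R) :
  continuous (Ival \o f) -> continuous f.
Proof. exact: continuous_comp_initial. Qed.

Lemma clamp_continuous : continuous clamp.
Proof.
apply: unitI_continuous => x; apply: (@continuous_max _ _ (cst 0)).
  exact: cst_continuous.
by apply: (@continuous_min _ _ (cst 1)) => //; exact: cst_continuous.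
Qed.

Lemma paste_continuous (T X : topologicalType) (g : T -> unitI R) (F G : T -> X) :
  continuous g -> continuous F -> continuous G ->
  (forall t, Ival (g t) = 2^-1 -> F t = G t) ->
  continuous (fun t => if Ival (g t) <= 2^-1 then F t else G t).
Proof.
move=> cg cF cG FG.
have cgI : continuous (Ival \o g).
  by move=> t; apply: continuous_comp; [exact: cg|exact: Ival_continuous].
pose A := (Ival \o g) @^-1` [set x | x <= 2^-1].
pose B := (Ival \o g) @^-1` [set x | 2^-1 <= x].
have AB : A `|` B = setT.
  by apply/seteqP; split => // t _; rewrite /A /B /=;
     case: (lerP (Ival (g t)) 2^-1) => h; [left|right; exact: ltW].
apply/continuous_subspace_setT; rewrite -AB.
apply: withinU_continuous.
- by apply: closed_comp; [move=> t _; exact: cgI|exact: closed_le].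
- by apply: closed_comp; [move=> t _; exact: cgI|exact: closed_ge].
- apply: (@subspace_eq_continuous _ _ _ F); last exact: continuous_subspaceT.
  by move=> t /set_mem tA; rewrite /from_subspace ifT.
- apply: (@subspace_eq_continuous _ _ _ G); last exact: continuous_subspaceT.
  move=> t /set_mem tB; rewrite /from_subspace; case: ifPn => // tA.
  by rewrite -FG//; apply/eqP; rewrite eq_le tA.
Qed.

End UnitInterval.

Section Paths.
Context (R : realType) {X : topologicalType}.
Implicit Types x y z : X.

Definition joined x y : bool := `[< inhabited {path unitI R from x to y} >].

Lemma joined_refl : reflexive joined.
Proof.
move=> x; rewrite /joined; apply/asboolP.
exact: (inhabits (cst x : {path unitI R from x to x})).
Qed.

Definition flipI (s : unitI R) : unitI R := clamp (1 - Ival s).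

Lemma flipI_continuous : continuous flipI.
Proof.
move=> s; apply: (@continuous_comp _ _ _ (fun s => 1 - Ival s)).
  by apply: continuousB; [exact: cst_continuous|exact: Ival_continuous].
exact: clamp_continuous.
Qed.

Lemma clamp0 (x : R) : x <= 0 -> clamp x = zero.
Proof.
move=> x0; apply: Ival_inj; rewrite /Ival /=.
by rewrite min_r ?max_l// (le_trans x0) ?ler01.
Qed.

Lemma clamp1 (x : R) : 1 <= x -> clamp x = one.
Proof. by move=> x1; apply: Ival_inj; rewrite /Ival /= min_l ?max_r ?ler01. Qed.

Lemma flipI0 : flipI zero = one.
Proof. by apply: clamp1; rewrite Ival0 subr0. Qed.

Lemma flipI1 : flipI one = zero.
Proof. by apply: clamp0; rewrite Ival1 subrr. Qed.

Lemma joined_sym : symmetric joined.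
Proof.
suff h x y : joined x y -> joined y x by move=> x y; apply/idP/idP; exact: h.
move=> /asboolP[p]; apply/asboolP.
have cp : continuous (p \o flipI).
  by move=> s; apply: continuous_comp; [exact: flipI_continuous|exact: cts_fun].
have p0 : (p \o flipI) zero = y by rewrite /= flipI0 path_one.
have p1 : (p \o flipI) one = x by rewrite /= flipI1 path_zero.
exact: (inhabits (mk_path cp p0 p1 : {path unitI R from y to x})).
Qed.

Definition fstI (s : unitI R) : unitI R := clamp (2 * Ival s).
Definition sndI (s : unitI R) : unitI R := clamp (2 * Ival s - 1).

Lemma fstI_continuous : continuous fstI.
Proof.
move=> s; apply: (@continuous_comp _ _ _ (fun s => 2 * Ival s)).
  by apply: continuousM; [exact: cst_continuous|exact: Ival_continuous].
exact: clamp_continuous.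
Qed.

Lemma sndI_continuous : continuous sndI.
Proof.
move=> s; apply: (@continuous_comp _ _ _ (fun s => 2 * Ival s - 1)).
  apply: continuousB; last exact: cst_continuous.
  by apply: continuousM; [exact: cst_continuous|exact: Ival_continuous].
exact: clamp_continuous.
Qed.

Lemma fstI0 : fstI zero = zero.
Proof. by apply: clamp0; rewrite Ival0 mulr0. Qed.

Lemma fstI1 : fstI one = one.
Proof. by apply: clamp1; rewrite Ival1; lra. Qed.

Lemma sndI0 : sndI zero = zero.
Proof. by apply: clamp0; rewrite Ival0; lra. Qed.

Lemma fstI_half s : Ival s = 2^-1 -> fstI s = one.
Proof. by move=> sh; apply: clamp1; rewrite sh divff ?pnatr_eq0. Qed.

Lemma sndI_half s : Ival s = 2^-1 -> sndI s = zero.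
Proof. by move=> sh; apply: clamp0; rewrite sh divff ?pnatr_eq0// subrr. Qed.

Lemma sndI1 : sndI one = one.
Proof. by apply: clamp1; rewrite Ival1; lra. Qed.

Lemma joined_trans : transitive joined.
Proof.
move=> y x z /asboolP[p] /asboolP[q]; apply/asboolP.
pose r s := if Ival s <= 2^-1 then p (fstI s) else q (sndI s).
have cr : continuous r.
  apply: (@paste_continuous _ _ _ id) => [|||s sh]; first by move=> s.
  - by move=> s; apply: continuous_comp; [exact: fstI_continuous|exact: (@cts_fun _ _ p)].
  - by move=> s; apply: continuous_comp; [exact: sndI_continuous|exact: (@cts_fun _ _ q)].
  - by rewrite fstI_half// sndI_half// path_one path_zero.
have r0 : r zero = x.
  by rewrite /r ifT ?fstI0 ?path_zero// Ival0 invr_ge0 ler0n.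
have r1 : r one = z.
  by rewrite /r ifF ?sndI1 ?path_one//; apply/negbTE; rewrite Ival1 -ltNge; lra.
exact: (inhabits (mk_path cr r0 r1 : {path unitI R from x to z})).
Qed.

Definition joined_equiv : equiv_rel X :=
  EquivRel joined joined_refl joined_sym joined_trans.

End Paths.

Definition pi0 (R : realType) (X : topologicalType) : Type :=
  {eq_quot (@joined_equiv R X)}.
HB.instance Definition _ R X := EqQuotient.on (pi0 R X).

Definition pi0_map (R : realType) (X Y : topologicalType)
    (f : continuousType X Y) (c : pi0 R X) : pi0 R Y :=
  \pi_(pi0 R Y) (f (repr c)).

Definition path_connected (R : realType) (X : topologicalType) (A : set X) :=
  forall x y, A x -> A y ->
    exists p : {path unitI R from x to y}, range p `<=` A.

Definition locally_path_connected (R : realType) (X : topologicalType) :=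
  forall (x : X) (U : set X), nbhs x U ->
    exists V : set X, [/\ open_nbhs x V, V `<=` U & path_connected R V].

Lemma connected_component_joined (R : realType) (X : topologicalType) :
  locally_path_connected R X ->
  forall x : X, connected_component [set: X] x = [set y | joined R x y].
Proof.
move=> lpc x; apply/seteqP; split=> y; last first.
  move=> /asboolP[p].
  pose q := p \o clamp.
  have cq : continuous q.
    move=> r; apply: continuous_comp; first exact: clamp_continuous.
    exact: (@cts_fun _ _ p).
  have q0 : q 0 = x by rewrite /q /= clamp0// path_zero.
  have q1 : q 1 = y by rewrite /q /= clamp1// path_one.
  exists (q @` `[0 : R, 1]); last by exists 1 => //=; rewrite in_itv /= ler01 lexx.
  split=> //; first by exists 0 => //=; rewrite in_itv /= ler01 lexx.
  apply: connected_continuous_connected; first exact: segment_connected.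
  exact: continuous_subspaceT.
have oJ (z : X) : open [set y | joined R z y].
  rewrite openE => u /= zu; rewrite /interior.
  have [V [[oV Vu] _ pV]] := lpc u setT filterT.
  apply: (@filterS _ _ _ V); last exact: open_nbhs_nbhs.
  move=> v Vv /=; apply: joined_trans zu _.
  by have [p _] := pV u v Vu Vv; apply/asboolP; exact: (inhabits p).
set C := connected_component _ _ => Cy.
have Cx : C x by exact: connected_component_refl.
suff /esym CE : C `&` [set y | joined R x y] = C by move: Cy; rewrite CE => -[].
have cC : connected C by exact: component_connected.
apply: cC; first by exists x; split=> //=; exact: joined_refl.
  by exists [set y | joined R x y].
exists [set y | joined R x y] => //; rewrite -openC.
rewrite (_ : ~` _ = \bigcup_(z in [set z | ~ joined R x z]) [set y | joined R z y]).
  by apply: bigcup_open => z _; exact: oJ.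
apply/seteqP; split=> u /=; first by exists u => //=; exact: joined_refl.
move=> [z /= nxz zu] xu; apply: nxz; apply: joined_trans xu _.
by rewrite joined_sym.
Qed.

Definition cube (R : realType) (n : nat) : Type := {ptws 'I_n -> unitI R}.
HB.instance Definition _ R n := Topological.on (cube R n).

Definition cube_boundary (R : realType) (n : nat) : set (cube R n) :=
  [set t | exists i, t i = zero \/ t i = one].

Definition homotopic_rel (R : realType) (K X : topologicalType) (A : set K)
    (a b : K -> X) : Prop :=
  exists H : unitI R * K -> X,
    [/\ continuous H,
        forall t, H (zero, t) = a t,
        forall t, H (one, t) = b t
      & forall s t, A t -> H (s, t) = a t].

Section HomotopyGroups.
Context (R : realType) {X : topologicalType} (n : nat) (x0 : X).

Definition spheroid : Type :=
  set_type [set a : cube R n -> X | continuous a /\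
    forall t, cube_boundary t -> a t = x0].
HB.instance Definition _ := Choice.on spheroid.

Lemma spheroid_continuous (a : spheroid) : continuous (\val a).
Proof. by have /set_mem[] := valP a. Qed.

Lemma spheroid_boundary (a : spheroid) t : cube_boundary t -> \val a t = x0.
Proof. by have /set_mem[_] := valP a; exact. Qed.

Definition mk_spheroid (a : cube R n -> X) (ca : continuous a)
  (a0 : forall t, cube_boundary t -> a t = x0) : spheroid :=
  SigSub (mem_set (conj ca a0)).

Definition homotopic (a b : spheroid) : bool :=
  `[< homotopic_rel R (@cube_boundary R n) (\val a) (\val b) >].

Lemma homotopic_refl : reflexive homotopic.
Proof.
move=> a; apply/asboolP; exists (fun st => \val a st.2); split=> //.
by move=> st; apply: continuous_comp; [exact: cvg_snd|exact: spheroid_continuous].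
Qed.

Lemma homotopic_sym : symmetric homotopic.
Proof.
suff h a b : homotopic a b -> homotopic b a
  by move=> a b; apply/idP/idP; exact: h.
move=> /asboolP[H [cH H0 H1 HA]]; apply/asboolP.
exists (fun st => H (flipI st.1, st.2)); split.
- by apply: comp_fst_continuous => //; exact: flipI_continuous.
- by move=> t; rewrite /= flipI0.
- by move=> t; rewrite /= flipI1.
- by move=> s t tA; rewrite /= HA// !spheroid_boundary.
Qed.

Lemma homotopic_trans : transitive homotopic.
Proof.
move=> b a c /asboolP[H [cH H0 H1 HA]] /asboolP[G [cG G0 G1 GA]]; apply/asboolP.
exists (fun st => if Ival st.1 <= 2^-1 then H (fstI st.1, st.2)
                  else G (sndI st.1, st.2)); split.
- apply: (@paste_continuous _ _ _ fst) => [st|||[s t]/= sh].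
  + exact: cvg_fst.
  + by apply: comp_fst_continuous => //; exact: fstI_continuous.
  + by apply: comp_fst_continuous => //; exact: sndI_continuous.
  + by rewrite fstI_half// sndI_half// H1 G0.
- by move=> t; rewrite ifT ?fstI0//= Ival0 invr_ge0 ler0n.
- by move=> t; rewrite ifF ?sndI1//=; apply/negbTE; rewrite Ival1 -ltNge; lra.
- by move=> s t tA /=; case: ifP => _; rewrite ?HA ?GA ?spheroid_boundary.
Qed.

Definition homotopic_equiv : equiv_rel spheroid :=
  EquivRel homotopic homotopic_refl homotopic_sym homotopic_trans.

Definition homotopy_group : Type := {eq_quot homotopic_equiv}.
HB.instance Definition _ := EqQuotient.on homotopy_group.

Lemma homotopicP (a b : spheroid) :
  \pi_homotopy_group a = \pi_homotopy_group b <->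
  homotopic_rel R (@cube_boundary R n) (\val a) (\val b).
Proof.
split=> [/eqmodP/asboolP //|h]; apply/eqmodP; exact/asboolP.
Qed.

End HomotopyGroups.

Section InducedMap.
Context (R : realType) {X Y : topologicalType} (n : nat) (x0 : X).
Context (f : continuousType X Y).

Lemma spheroid_map_continuous (a : spheroid R n x0) : continuous (f \o \val a).
Proof.
by move=> t; apply: continuous_comp; [exact: spheroid_continuous|exact: cts_fun].
Qed.

Lemma spheroid_map_boundary (a : spheroid R n x0) t :
  cube_boundary t -> (f \o \val a) t = f x0.
Proof. by move=> tA; rewrite /= spheroid_boundary. Qed.

Definition spheroid_map (a : spheroid R n x0) : spheroid R n (f x0) :=
  mk_spheroid (@spheroid_map_continuous a) (@spheroid_map_boundary a).

Definition homotopy_map (c : homotopy_group R n x0) :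
    homotopy_group R n (f x0) :=
  \pi_(homotopy_group R n (f x0)) (spheroid_map (repr c)).

Lemma homotopy_mapE (a : spheroid R n x0) :
  homotopy_map (\pi_(homotopy_group R n x0) a) =
  \pi_(homotopy_group R n (f x0)) (spheroid_map a).
Proof.
apply/homotopicP.
have /homotopicP[H [cH H0 H1 HA]] :
    \pi_(homotopy_group R n x0) (repr (\pi_(homotopy_group R n x0) a)) =
    \pi_(homotopy_group R n x0) a by rewrite reprK.
exists (f \o H); split => [st|t|t|s t tA] /=.
- by apply: continuous_comp; [exact: cH|exact: cts_fun].
- by rewrite H0.
- by rewrite H1.
- by rewrite HA.
Qed.

End InducedMap.

Section GroupLaw.
Context {R : realType} {X : topologicalType} {n : nat} {x0 : X}.

Definition set_coord0 (s : unitI R) (t : cube R n.+1) : cube R n.+1 :=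
  fun i => if i == ord0 then s else t i.

Lemma coord_continuous m (i : 'I_m) : continuous (fun t : cube R m => t i).
Proof. exact: (@proj_continuous _ (fun _ => unitI R) i). Qed.

Lemma cube_continuous (T : topologicalType) m (f : T -> cube R m) :
  (forall i, continuous (fun t => f t i)) -> continuous f.
Proof.
move=> cf t; apply/cvg_sup => i.
exact: (@continuous_comp_initial _ _ _ (fun f : cube R m => f i) f (cf i)).
Qed.

Lemma set_coord0_continuous (u : unitI R -> unitI R) :
  continuous u -> continuous (fun t : cube R n.+1 => set_coord0 (u (t ord0)) t).
Proof.
move=> cu; apply: cube_continuous => i; rewrite /set_coord0.
case: eqP => _; last exact: coord_continuous.
move=> t; apply: (@continuous_comp _ _ _ (fun t : cube R n.+1 => t ord0)).
  exact: coord_continuous.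
exact: cu.
Qed.

Lemma set_coord0_boundary (s : unitI R) (t : cube R n.+1) :
  s = zero \/ s = one -> cube_boundary (set_coord0 s t).
Proof. by move=> s01; exists ord0; rewrite /set_coord0 eqxx. Qed.

Lemma set_coord0_endo (u : unitI R -> unitI R) (t : cube R n.+1) :
  u zero = zero -> u one = one ->
  cube_boundary t -> cube_boundary (set_coord0 (u (t ord0)) t).
Proof.
move=> u0 u1 [i ti]; exists i; rewrite /set_coord0.
by case: eqP ti => [->|//] [->|->]; [left|right].
Qed.

(* [fstI s = min 1 (2 s)] and [sndI s = max 0 (2 s - 1)], so this is the usual
   concatenation along the first coordinate. *)
Definition concat_fun (a b : cube R n.+1 -> X) (t : cube R n.+1) : X :=
  if Ival (t ord0) <= 2^-1 then a (set_coord0 (fstI (t ord0)) t)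
  else b (set_coord0 (sndI (t ord0)) t).

Lemma concat_continuous (T : topologicalType) (g : T -> cube R n.+1)
    (F G : T * cube R n.+1 -> X) :
  continuous g -> continuous F -> continuous G ->
  (forall t r, cube_boundary r -> F (t, r) = x0) ->
  (forall t r, cube_boundary r -> G (t, r) = x0) ->
  continuous (fun t => concat_fun (fun r => F (t, r)) (fun r => G (t, r)) (g t)).
Proof.
move=> cg cF cG F0 G0; rewrite /concat_fun.
have cid : continuous (@idfun T) by move=> ?.
have cc (u : unitI R -> unitI R) (H : T * cube R n.+1 -> X) :
    continuous u -> continuous H ->
    continuous (fun t => H (t, set_coord0 (u (g t ord0)) (g t))).
  move=> cu cH t.
  apply: (@continuous_comp _ _ _ (fun t => (t, set_coord0 (u (g t ord0)) (g t))));
    last exact: cH.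
  apply: pair_continuous => // {}t.
  apply: (@continuous_comp _ _ _ g
    (fun r : cube R n.+1 => set_coord0 (u (r ord0)) r)); first exact: cg.
  exact: set_coord0_continuous.
apply: (@paste_continuous _ _ _ (fun t => g t ord0)).
- move=> t; apply: (@continuous_comp _ _ _ g (fun r : cube R n.+1 => r ord0)).
    exact: cg.
  exact: coord_continuous.
- by apply: cc => //; exact: fstI_continuous.
- by apply: cc => //; exact: sndI_continuous.
- move=> t th; rewrite fstI_half// sndI_half// F0 ?G0//;
    apply: set_coord0_boundary; [by left|by right].
Qed.

Section Concat.
Variables a b : spheroid R n.+1 x0.

Lemma concat_fun_continuous : continuous (concat_fun (\val a) (\val b)).
Proof.
have ct (c : spheroid R n.+1 x0) :
    continuous (fun tr : cube R n.+1 * cube R n.+1 => \val c tr.2).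
  move=> tr; apply: (@continuous_comp _ _ _ snd); first exact: cvg_snd.
  exact: spheroid_continuous.
apply: (@concat_continuous _ id _ _ _ (ct a) (ct b)) => [t|t r rA|t r rA].
- by [].
- exact: spheroid_boundary.
- exact: spheroid_boundary.
Qed.

Lemma concat_fun_boundary (t : cube R n.+1) :
  cube_boundary t -> concat_fun (\val a) (\val b) t = x0.
Proof.
move=> tA; rewrite /concat_fun; case: ifP => _; apply: spheroid_boundary.
  by apply: set_coord0_endo; rewrite ?fstI0 ?fstI1.
by apply: set_coord0_endo; rewrite ?sndI0 ?sndI1.
Qed.

Definition concat : spheroid R n.+1 x0 :=
  mk_spheroid concat_fun_continuous concat_fun_boundary.

End Concat.

Definition homotopy_mul (c d : homotopy_group R n.+1 x0) :
    homotopy_group R n.+1 x0 :=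
  \pi_(homotopy_group R n.+1 x0) (concat (repr c) (repr d)).

HB.instance Definition _ := hasMul.Build (homotopy_group R n.+1 x0) homotopy_mul.

Lemma homotopy_mulE (a b : spheroid R n.+1 x0) :
  (\pi_(homotopy_group R n.+1 x0) a * \pi_(homotopy_group R n.+1 x0) b)%g =
  \pi_(homotopy_group R n.+1 x0) (concat a b).
Proof.
apply/homotopicP.
have rep (c : spheroid R n.+1 x0) :
    homotopic_rel R (@cube_boundary R n.+1)
      (\val (repr (\pi_(homotopy_group R n.+1 x0) c))) (\val c).
  by apply/homotopicP; rewrite reprK.
have [H [cH H0 H1 HA]] := rep a.
have [G [cG G0 G1 GA]] := rep b.
exists (fun st => concat_fun (fun r => H (st.1, r)) (fun r => G (st.1, r)) st.2).
split=> [|t|t|s t tA] /=.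
- have c1 (K : unitI R * cube R n.+1 -> X) : continuous K ->
      continuous (fun tr : (unitI R * cube R n.+1) * cube R n.+1 => K (tr.1.1, tr.2)).
    by move=> cK; apply: comp_fst_continuous => // st; exact: cvg_fst.
  apply: (@concat_continuous _ snd _ _ _ (c1 _ cH) (c1 _ cG)) => [st|st r rA|st r rA] /=.
  + exact: cvg_snd.
  + by rewrite HA// spheroid_boundary.
  + by rewrite GA// spheroid_boundary.
- by rewrite /concat_fun; case: ifP => _; rewrite ?H0 ?G0.
- by rewrite /concat_fun; case: ifP => _; rewrite ?H1 ?G1.
- rewrite /concat_fun; case: ifP => _; rewrite ?HA ?GA//.
    by apply: set_coord0_endo; rewrite ?fstI0 ?fstI1.
  by apply: set_coord0_endo; rewrite ?sndI0 ?sndI1.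
Qed.

End GroupLaw.

(* [pi0] is treated separately from the pointed invariants so that the empty
   space is handled correctly; for [n.+1], a bijection compatible with the
   product is an isomorphism of groups. *)
Definition weak_homotopy_equivalence (R : realType) (X Y : topologicalType)
    (f : X -> Y) : Prop :=
  exists cf : continuous f,
    bijective (pi0_map (R := R) (mkcts cf)) /\
    forall (n : nat) (x0 : X),
      bijective (homotopy_map (R := R) (n := n.+1) (x0 := x0) (mkcts cf)) /\
      {morph homotopy_map (R := R) (n := n.+1) (x0 := x0) (mkcts cf) :
        c d / (c * d)%g}.

Section Exponentials.
Variable X : topologicalType.

Definition Exp : Type := {fset X}.
HB.instance Definition _ := Choice.on Exp.
HB.instance Definition _ :=
  isMonoid.Build Exp (@fsetUA X) (@fset0U X) (@fsetU0 X).

Definition tuple_set (n : nat) (x : {ptws 'I_n -> X}) : Exp :=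
  [fset x i | i in 'I_n]%fset.

(* The final topology for the family [tuple_set], i.e. the finest one making all
   these maps continuous. *)
Definition expT_open : set_system Exp :=
  [set V | forall n, open (@tuple_set n @^-1` V)].

Lemma expT_openT : expT_open setT.
Proof. by move=> n; rewrite preimage_setT; exact: openT. Qed.

Lemma expT_openI : setI_closed expT_open.
Proof. by move=> A B oA oB n; rewrite preimage_setI; exact: openI. Qed.

Lemma expT_open_bigU (I : Type) (f : I -> set Exp) :
  (forall i, expT_open (f i)) -> expT_open (\bigcup_i f i).
Proof.
by move=> of_ n; rewrite preimage_bigcup; apply: bigcup_open => i _; exact: of_.
Qed.

Definition ExpT : Type := Exp.
HB.instance Definition _ := Monoid.on ExpT.
HB.instance Definition _ :=
  isOpenTopological.Build ExpT expT_openT expT_openI expT_open_bigU.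

(* This is the Vietoris topology. The covering condition [S `<=` \bigcup U] is
   part of the definition: the sets of all [S] that merely meet every [U] are
   upward closed, so in the topology which they generate the only neighborhood
   of the empty subset is the whole space, and no map to a discrete space that
   tells the empty subset from the others is continuous. *)
Definition meeting_cover (F : set (set X)) : set Exp :=
  [set S : Exp | [set` (S : {fset X})] `<=` \bigcup_(U in F) U /\
    forall U, F U -> [set` (S : {fset X})] `&` U !=set0].

Definition ExpM : Type := Exp.
HB.instance Definition _ := Monoid.on ExpM.
HB.instance Definition _ :=
  isSubBaseTopological.Build ExpM
    [set meeting_cover F | F in [set F | finite_set F /\ F `<=` open]] id.

(* In a locally path connected space these are also the path components: see
   [connected_component_joined]. *)
Definition components : Type :=
  set_type (range (connected_component [set: X])).

(* [bool] with [||] is the monoid I_2. *)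
Definition finsupp_families : Type :=
  set_type [set f : components -> bool | finite_set [set i | f i]].

HB.instance Definition _ := Choice.on finsupp_families.

Definition mk_family (f : components -> bool) (ff : finite_set [set i | f i]) :
  finsupp_families := exist _ f (mem_set ff).

Lemma finsupp0 : finite_set [set i : components | false].
Proof. by apply: (sub_finite_set _ (finite_set0 _)). Qed.

Lemma finsuppU (f g : finsupp_families) :
  finite_set [set i | \val f i || \val g i].
Proof.
apply: (sub_finite_set (B := [set i | \val f i] `|` [set i | \val g i])).
  by move=> i /= /orP.
by rewrite finite_setU; split; [exact: set_mem (valP f)|exact: set_mem (valP g)].
Qed.

Definition sum_zero : finsupp_families := mk_family finsupp0.
Definition sum_or (f g : finsupp_families) : finsupp_families :=
  mk_family (finsuppU f g).

Lemma sum_orA : associative sum_or.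
Proof. by move=> f g h; apply: val_inj; apply/funext => i /=; rewrite orbA. Qed.
Lemma sum_or0f : left_id sum_zero sum_or.
Proof. by move=> f; apply: val_inj; apply/funext. Qed.
Lemma sum_orf0 : right_id sum_zero sum_or.
Proof. by move=> f; apply: val_inj; apply/funext => i /=; rewrite orbF. Qed.

Definition direct_sum_I2 : Type := discrete_topology finsupp_families.
HB.instance Definition _ := DiscreteTopology.on direct_sum_I2.
HB.instance Definition _ :=
  isMonoid.Build direct_sum_I2 sum_orA sum_or0f sum_orf0.

Lemma exists_finsupp (S : Exp) :
  finite_set [set i : components |
    `[< exists2 x, x \in (S : {fset X}) & \val i x >]].
Proof.
pose k (x : X) : components :=
  SigSub (mem_set (imageT (connected_component [set: X]) x)).
apply: (sub_finite_set (B := k @` [set` (S : {fset X})])).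
  move=> i /= /asboolP[x xS ix]; exists x => //; apply: val_inj => /=.
  have /set_mem[y _ yi] := valP i; move: ix; rewrite -yi => ix.
  exact/esym/same_connected_component.
exact/finite_image/finite_fset.
Qed.

Definition exists_map (S : Exp) : direct_sum_I2 := mk_family (exists_finsupp S).

Definition exists_M : ExpM -> direct_sum_I2 := exists_map.
Definition exists_T : ExpT -> direct_sum_I2 := exists_map.

End Exponentials.

(* Main.v *)
(* Union makes Exp(X) a commutative idempotent monoid, and it is continuous on
   maps out of a compact space. This alone kills every homotopy group: if b is
   a spheroid at S0 with all values containing S0, and b' is its reverse along
   one coordinate, then moving the supports of b and b' apart turns the pointwise
   union b \/ b' into the concatenation of b and b', which is null-homotopic;
   hence b = b \/ S0 ~ b \/ (b \/ b') = b \/ b' ~ S0. For an arbitrary spheroid a,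
   moving the supports of the two factors of a = a \/ a apart shows that a is
   homotopic to the concatenation of a \/ S0 with itself, hence to S0.
   On pi_0, a finite set S is joined to S together with t as soon as t is joined
   to some s in S, by moving a second copy of s to t.
   In Exp_T(X), with X Hausdorff, compact families of finite sets have bounded
   cardinality, and on sets of bounded cardinality the topology is that of
   Exp_M(X); so union is again continuous on compact spaces. *)
Require Import Defs.
From HB Require Import structures.
From mathcomp Require Import all_boot all_order all_algebra.
From mathcomp Require Import generic_quotient finmap lra.
From mathcomp Require Import all_classical all_reals topology normedtype homotopy.

Local Open Scope classical_set_scope.

Section HomotopyOfExponentials.
Import Order.TTheory GRing.Theory Num.Theory.
Import numFieldNormedType.Exports.
Local Open Scope ring_scope.
Local Open Scope quotient_scope.
Set Implicit Arguments.
Unset Strict Implicit.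
Unset Printing Implicit Defensive.

(** * Compactness of the interval and of cubes; maps from the interval to discrete spaces *)

Lemma clamp_val (R : realType) (s : unitI R) : clamp (Ival s) = s.
Proof.
apply: Ival_inj; have /andP[s0 s1] := Ival_itv s.
by rewrite {1}/Ival /= min_r// max_r.
Qed.

Lemma unitI_compact (R : realType) : compact [set: unitI R].
Proof.
rewrite (_ : [set: unitI R] = (@clamp R) @` `[0 : R, 1]).
  apply: continuous_compact; last exact: segment_compact.
  exact/continuous_subspaceT/clamp_continuous.
apply/seteqP; split=> // s _; exists (Ival s); last exact: clamp_val.
by rewrite /= in_itv /=; exact: Ival_itv.
Qed.

Lemma cube_compact (R : realType) n : compact [set: cube R n].
Proof.
have := @tychonoff _ (fun _ : 'I_n => unitI R) (fun _ => setT)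
  (fun _ => @unitI_compact R).
by congr (compact _); apply/seteqP; split.
Qed.

(** Pulled back to the real line along [clamp], each fibre of [f] becomes clopen, so connectedness
    of the line applies. *)
Lemma unitI_discrete_cst (R : realType) (T : discreteTopologicalType)
    (f : unitI R -> T) :
  continuous f -> forall s t, f s = f t.
Proof.
move=> cf s t.
have cg : continuous (f \o @clamp R).
  by move=> r; apply: continuous_comp; [exact: clamp_continuous|exact: cf].
have cT : connected [set: R] by apply/connected_intervalP => x y _ _ z _.
pose B := (f \o @clamp R) @^-1` [set f s].
have BT : B = setT.
  apply: cT; first by exists (Ival s); rewrite /B /= clamp_val.
    exists B; last by rewrite setTI.
    by apply: open_comp => //; exact: discrete_open.
  exists B; last by rewrite setTI.
  by apply: closed_comp => //; exact: discrete_closed.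
have : B (Ival t) by rewrite BT.
by rewrite /B /= clamp_val.
Qed.

(** * Reparametrization of spheroids along the first coordinate *)

Section Reparametrization.
Context (R : realType) (X : topologicalType) (n : nat) (x0 : X).
Implicit Types (a b : spheroid R n.+1 x0) (u v : unitI R -> unitI R).

Definition endpoint (s : unitI R) : Prop := s = zero \/ s = one.

Definition reparam_fun u (f : cube R n.+1 -> X) (t : cube R n.+1) : X :=
  f (set_coord0 (u (t ord0)) t).

Lemma set_coord0_bnd u (t : cube R n.+1) :
  endpoint (u zero) -> endpoint (u one) ->
  cube_boundary t -> cube_boundary (set_coord0 (u (t ord0)) t).
Proof.
move=> u0 u1 [i ti]; exists i; rewrite /set_coord0; case: eqP => // ei.
by move: ti; rewrite ei => -[->|->].
Qed.

Lemma reparam_fun_continuous u a :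
  continuous u -> continuous (reparam_fun u (\val a)).
Proof.
move=> cu t; apply: (@continuous_comp _ _ _
  (fun t : cube R n.+1 => set_coord0 (u (t ord0)) t)).
  exact: set_coord0_continuous.
exact: spheroid_continuous.
Qed.

Lemma reparam_fun_boundary u a :
  endpoint (u zero) -> endpoint (u one) ->
  forall t, cube_boundary t -> reparam_fun u (\val a) t = x0.
Proof. by move=> u0 u1 t tA; apply/spheroid_boundary/set_coord0_bnd. Qed.

(** [u] need only send endpoints to endpoints, so reversal, the tent map and the constant map at
    [zero] are all admissible. *)
Definition reparam u (cu : continuous u) (u0 : endpoint (u zero))
    (u1 : endpoint (u one)) a : spheroid R n.+1 x0 :=
  mk_spheroid (@reparam_fun_continuous u a cu)
    (@reparam_fun_boundary u a u0 u1).

(** The straight-line homotopy from [u] to [v]. The convex combination already lies in [0,1];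
    [clamp] only gives it the type [unitI R]. *)
Definition segI u v (s r : unitI R) : unitI R :=
  clamp ((1 - Ival s) * Ival (u r) + Ival s * Ival (v r)).

Lemma segI_continuous u v : continuous u -> continuous v ->
  continuous (fun sr : unitI R * unitI R => segI u v sr.1 sr.2).
Proof.
move=> cu cv sr; apply: (@continuous_comp _ _ _ (fun sr : unitI R * unitI R =>
  (1 - Ival sr.1) * Ival (u sr.2) + Ival sr.1 * Ival (v sr.2)));
  last exact: clamp_continuous.
have c1 : continuous (fun sr : unitI R * unitI R => Ival sr.1).
  by move=> x; apply: continuous_comp; [exact: cvg_fst|exact: Ival_continuous].
have c2 w : continuous w -> continuous (fun sr : unitI R * unitI R => Ival (w sr.2)).
  move=> cw x; apply: (@continuous_comp _ _ _ snd (fun r => Ival (w r))).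
    exact: cvg_snd.
  by apply: continuous_comp; [exact: cw|exact: Ival_continuous].
apply: continuousD; last by apply: continuousM; [exact: c1|exact: c2].
apply: continuousM; last exact: c2.
by apply: continuousB; [exact: cst_continuous|exact: c1].
Qed.

(** The straight-line homotopy fixes every value on which [u] and [v] agree, in particular both
    endpoints, so the boundary of the cube still goes to [x0]. *)
Lemma reparam_homotopic u v a (cu : continuous u) (cv : continuous v)
    (u0 : endpoint (u zero)) (u1 : endpoint (u one))
    (v0 : endpoint (v zero)) (v1 : endpoint (v one)) :
  u zero = v zero -> u one = v one ->
  homotopic (reparam cu u0 u1 a) (reparam cv v0 v1 a).
Proof.
move=> uv0 uv1; apply/asboolP.
have sE s r : u r = v r -> segI u v s r = u r.
  by move=> uv; rewrite /segI -uv -mulrDl subrK mul1r clamp_val.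
exists (fun st => reparam_fun (segI u v st.1) (\val a) st.2); split=> /=.
- move=> st; apply: (@continuous_comp _ _ _
    (fun st : unitI R * cube R n.+1 =>
       set_coord0 (segI u v st.1 (st.2 ord0)) st.2)); last first.
    exact: spheroid_continuous.
  have c2 (i : 'I_n.+1) : continuous (fun st : unitI R * cube R n.+1 => st.2 i).
    move=> x; apply: (@continuous_comp (unitI R * cube R n.+1)%type (cube R n.+1)
      (unitI R) snd (fun t => t i)).
      exact: cvg_snd.
    exact: Defs.coord_continuous.
  apply: cube_continuous => i; rewrite /set_coord0; case: eqP => _ //.
  move=> x; apply: (@continuous_comp _ _ _
    (fun st : unitI R * cube R n.+1 => (st.1, st.2 ord0))
    (fun sr => segI u v sr.1 sr.2)); last exact: segI_continuous.
  by apply: pair_continuous => // {}x; exact: cvg_fst.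
- by move=> t; rewrite /reparam_fun /segI Ival0 subr0 mul1r mul0r addr0 clamp_val.
- by move=> t; rewrite /reparam_fun /segI Ival1 subrr mul1r mul0r add0r clamp_val.
- move=> s t tA; rewrite reparam_fun_boundary ?sE//.
  by rewrite (@reparam_fun_boundary u).
Qed.

End Reparametrization.

(** * Null-homotopy of spheroids in a commutative idempotent monoid *)

Section IdempotentMonoid.
Context (R : realType) (E : topologicalType) (op : E -> E -> E).
Hypothesis opA : associative op.
Hypothesis opC : commutative op.
Hypothesis opI : idempotent_op op.
(** Continuity is asked over compact [K]: this is what can be proved for union in Exp_T(X), and
    cubes and homotopies between spheroids have compact domains. *)
Hypothesis op_continuous : forall (K : topologicalType) (F G : K -> E),
  compact [set: K] -> continuous F -> continuous G ->
  continuous (fun t => op (F t) (G t)).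

Section Spheroids.
Context (n : nat) (x0 : E).
Implicit Types a b c d : spheroid R n.+1 x0.

Lemma sph_op_continuous a b : continuous (fun t => op (\val a t) (\val b t)).
Proof.
by apply: op_continuous; [exact: cube_compact| |]; exact: spheroid_continuous.
Qed.

Lemma sph_op_boundary a b t : cube_boundary t -> op (\val a t) (\val b t) = x0.
Proof. by move=> tA; rewrite !spheroid_boundary. Qed.

Definition sph_op a b : spheroid R n.+1 x0 :=
  mk_spheroid (@sph_op_continuous a b)
    (@sph_op_boundary a b).

Definition sph_cst : spheroid R n.+1 x0 :=
  mk_spheroid (@cst_continuous (cube R n.+1) E x0) (fun _ _ => erefl).

Lemma sph_op_homotopic a b c d :
  homotopic a b -> homotopic c d -> homotopic (sph_op a c) (sph_op b d).
Proof.
move=> /asboolP[H [cH H0 H1 HA]] /asboolP[G [cG G0 G1 GA]]; apply/asboolP.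
exists (fun st => op (H st) (G st)); split=> [|t|t|s t tA] /=.
- apply: op_continuous => //; rewrite -setXTT.
  by apply: compact_setX; [exact: unitI_compact|exact: cube_compact].
- by rewrite H0 G0.
- by rewrite H1 G1.
- by rewrite HA// GA.
Qed.

Lemma endpoint0 : endpoint (zero : unitI R). Proof. by left. Qed.
Lemma endpoint1 : endpoint (one : unitI R). Proof. by right. Qed.
Hint Resolve endpoint0 endpoint1 : core.

(** Reparametrizing by this map gives a spheroid followed by its own reverse. *)
Definition tentI (s : unitI R) : unitI R :=
  if Ival s <= 2^-1 then fstI s else flipI (sndI s).

Lemma flipI_sndI_continuous : continuous (fun s : unitI R => flipI (sndI s)).
Proof.
by move=> s; apply: continuous_comp;
  [exact: sndI_continuous|exact: flipI_continuous].
Qed.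

Lemma tentI_continuous : continuous tentI.
Proof.
apply: (@paste_continuous _ _ _ id).
- by move=> s.
- exact: fstI_continuous.
- exact: flipI_sndI_continuous.
- by move=> s sh; rewrite fstI_half// sndI_half// flipI0.
Qed.

Lemma tentI0 : tentI zero = zero.
Proof. by rewrite /tentI Ival0 invr_ge0 ler0n fstI0. Qed.

Lemma tentI1 : tentI one = zero.
Proof. by rewrite /tentI Ival1 ifF ?sndI1 ?flipI1//; apply/negbTE; lra. Qed.

Lemma fstI_right (s : unitI R) : 2^-1 <= Ival s -> fstI s = one.
Proof. by move=> sh; apply: clamp1; lra. Qed.

Lemma sndI_left (s : unitI R) : Ival s <= 2^-1 -> sndI s = zero.
Proof. by move=> sh; apply: clamp0; lra. Qed.

Lemma reparam_fun_endpoint (u : unitI R -> unitI R) b t :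
  endpoint (u (t ord0)) -> reparam_fun u (\val b) t = x0.
Proof. by move=> ut; apply: spheroid_boundary; exact: set_coord0_boundary. Qed.

Lemma reparam_id_homotopic (u : unitI R -> unitI R) b (cu : continuous u)
    (u0 : endpoint (u zero)) (u1 : endpoint (u one)) :
  u zero = zero -> u one = one -> homotopic b (reparam cu u0 u1 b).
Proof.
move=> uz uo; have cid : continuous (@idfun (unitI R)) by move=> ?.
have {1}-> : b = reparam cid endpoint0 endpoint1 b.
  apply: val_inj; apply/funext => t /=; congr (\val b _).
  by apply/funext => i; rewrite /set_coord0; case: eqP => [->|].
by apply: reparam_homotopic.
Qed.

Lemma reparam_zero_homotopic (u : unitI R -> unitI R) b (cu : continuous u)
    (u0 : endpoint (u zero)) (u1 : endpoint (u one)) :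
  u zero = zero -> u one = zero -> homotopic (reparam cu u0 u1 b) sph_cst.
Proof.
move=> uz uo; have cz : continuous (fun _ : unitI R => zero : unitI R).
  exact: cst_continuous.
have -> : sph_cst = reparam cz endpoint0 endpoint0 b.
  by apply: val_inj; apply/funext => t /=; rewrite reparam_fun_endpoint.
exact: reparam_homotopic.
Qed.

(** The hypothesis says that each value of [b] absorbs [x0]. The product of [b] with its reverse [B]
    is null-homotopic and, by idempotence, absorbs [b]. *)
Lemma absorbing_null b : sph_op b sph_cst = b -> homotopic b sph_cst.
Proof.
move=> bE.
have bxE r : op (\val b r) x0 = \val b r.
  by have /(congr1 val)/(congr1 (fun f => f r)) := bE.
have eF1 : endpoint (fstI (one : unitI R)) by rewrite fstI1.
have eF0 : endpoint (fstI (zero : unitI R)) by rewrite fstI0.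
have eB0 : endpoint (flipI (zero : unitI R)) by rewrite flipI0.
have eB1 : endpoint (flipI (one : unitI R)) by rewrite flipI1.
have eG0 : endpoint (flipI (sndI (zero : unitI R))) by rewrite sndI0.
have eG1 : endpoint (flipI (sndI (one : unitI R))) by rewrite sndI1.
have eT0 : endpoint (tentI zero) by rewrite tentI0.
have eT1 : endpoint (tentI one) by rewrite tentI1.
(* [F] runs through [b] in the first half and [G] through its reverse in the second; elsewhere each
   is constant at [x0], which the other absorbs. *)
pose F := reparam (@fstI_continuous R) eF0 eF1 b.
pose B := reparam (@flipI_continuous R) eB0 eB1 b.
pose G := reparam flipI_sndI_continuous eG0 eG1 b.
have tentE : reparam tentI_continuous eT0 eT1 b = sph_op F G.
  apply: val_inj; apply/funext => t /=; rewrite {1}/reparam_fun /tentI.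
  case: (lerP (Ival (t ord0)) 2^-1) => [tl|/ltW tr].
    by rewrite (@reparam_fun_endpoint (fun s => flipI (sndI s))) ?sndI_left ?flipI0//
      /reparam_fun bxE.
  by rewrite (@reparam_fun_endpoint (@fstI R)) ?fstI_right// opC /reparam_fun bxE.
have FG : homotopic (sph_op F G) sph_cst.
  by rewrite -tentE; apply: reparam_zero_homotopic; rewrite ?tentI0 ?tentI1.
have bB : homotopic (sph_op b B) sph_cst.
  apply: homotopic_trans FG; apply: sph_op_homotopic.
    by apply: reparam_id_homotopic; rewrite ?fstI0 ?fstI1.
  by apply: reparam_homotopic; rewrite ?sndI0 ?sndI1.
have bbB : sph_op b (sph_op b B) = sph_op b B.
  by apply: val_inj; apply/funext => t /=; rewrite opA opI.
(* With \/ for [op], the chain is b = b \/ x0 ~ b \/ (b \/ B) = b \/ B ~ x0. *)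
apply: (homotopic_trans _ bB); rewrite -bbB -{1}bE.
apply: sph_op_homotopic; first exact: homotopic_refl.
by rewrite homotopic_sym.
Qed.

Lemma spheroid_null a : homotopic a sph_cst.
Proof.
have eF1 : endpoint (fstI (one : unitI R)) by rewrite fstI1.
have eF0 : endpoint (fstI (zero : unitI R)) by rewrite fstI0.
have eS1 : endpoint (sndI (one : unitI R)) by rewrite sndI1.
have eS0 : endpoint (sndI (zero : unitI R)) by rewrite sndI0.
pose F c := reparam (@fstI_continuous R) eF0 eF1 c : spheroid R n.+1 x0.
pose S c := reparam (@sndI_continuous R) eS0 eS1 c : spheroid R n.+1 x0.
pose b := sph_op a sph_cst.
have bE : sph_op b sph_cst = b.
  by apply: val_inj; apply/funext => t /=; rewrite -opA opI.
(* On each half one factor is [x0], so joining with it already turns the value of [a] into that of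
   [b]. *)
have FbSb : sph_op (F a) (S a) = sph_op (F b) (S b).
  apply: val_inj; apply/funext => t /=.
  case: (lerP (Ival (t ord0)) 2^-1) => [tl|/ltW tr].
    have aS : \val a (set_coord0 (sndI (t ord0)) t) = x0.
      by apply: (@reparam_fun_endpoint (@sndI R)); rewrite sndI_left.
    by rewrite /b /reparam_fun /= aS opI -opA opI.
  have aF : \val a (set_coord0 (fstI (t ord0)) t) = x0.
    by apply: (@reparam_fun_endpoint (@fstI R)); rewrite fstI_right.
  by rewrite /b /reparam_fun /= aF opI opA (opC (op x0 _)) opA opI.
have Fc c : homotopic c (F c).
  by apply: reparam_id_homotopic; rewrite ?fstI0 ?fstI1.
have Sc c : homotopic c (S c).
  by apply: reparam_id_homotopic; rewrite ?sndI0 ?sndI1.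
have aE : a = sph_op a a by apply: val_inj; apply/funext => t /=; rewrite opI.
have cE : sph_cst = sph_op sph_cst sph_cst.
  by apply: val_inj; apply/funext => t /=; rewrite opI.
have bc : homotopic b sph_cst by exact: absorbing_null.
rewrite aE; apply: (@homotopic_trans _ _ _ _ (sph_op (F a) (S a))).
  exact: sph_op_homotopic.
rewrite FbSb cE; apply: sph_op_homotopic.
  by apply: homotopic_trans bc; rewrite homotopic_sym.
by apply: homotopic_trans bc; rewrite homotopic_sym.
Qed.

Lemma homotopy_group_trivial (c d : homotopy_group R n.+1 x0) : c = d.
Proof.
suff h e : e = \pi_(homotopy_group R n.+1 x0) sph_cst by rewrite (h c) (h d).
rewrite -[e]reprK; apply/eqmodP; exact: spheroid_null.
Qed.

End Spheroids.
End IdempotentMonoid.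

(** * Weak equivalences to discrete spaces *)

Section DiscreteTarget.
Context (R : realType) (E : topologicalType) (Y : discreteTopologicalType).
Variables (f : E -> Y) (cf : continuous f).

Lemma joined_discrete (x y : Y) : joined R x y -> x = y.
Proof.
move=> /asboolP[p]; have : p zero = p one; last by rewrite path_zero path_one.
by apply: unitI_discrete_cst; exact: cts_fun.
Qed.

Lemma joined_image x y : joined R x y -> f x = f y.
Proof.
move=> /asboolP[p]; have : f (p zero) = f (p one); last by rewrite path_zero path_one.
apply: (@unitI_discrete_cst _ _ (f \o p)) => s.
by apply: continuous_comp; [exact: cts_fun|exact: cf].
Qed.

(** Sliding the first coordinate to [zero] brings any point of the cube to the boundary without
    changing the value of the spheroid. *)
Lemma cube_discrete_cst n (y0 : Y) (a b : spheroid R n.+1 y0) : a = b.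
Proof.
suff h (c : spheroid R n.+1 y0) t : \val c t = y0.
  by apply: val_inj; apply/funext => t; rewrite !h.
have ct : continuous (fun s => \val c (set_coord0 s t)).
  move=> s; apply: (@continuous_comp (unitI R) (cube R n.+1) Y
    (fun s => set_coord0 s t)); last exact: spheroid_continuous.
  apply: cube_continuous => i; rewrite /set_coord0; case: eqP => _ => {}s.
    by [].
  exact: cst_continuous.
have -> : t = set_coord0 (t ord0) t.
  by apply/funext => i; rewrite /set_coord0; case: eqP => [->|].
rewrite (unitI_discrete_cst ct _ zero); apply: spheroid_boundary.
by apply: set_coord0_boundary; left.
Qed.

(** In positive degrees the groups on both sides are trivial, so only pi_0 remains, and the path
    components of [Y] are its points. *)
Lemma weak_equivalence_discrete :
  (forall y, exists x, f x = y) ->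
  (forall x y, f x = f y -> joined R x y) ->
  (forall n (x0 : E) (c d : homotopy_group R n.+1 x0), c = d) ->
  weak_homotopy_equivalence R f.
Proof.
move=> fsurj finj htriv; exists cf; split.
  rewrite -setTT_bijective; split=> // [c d _ _|d _].
    move=> /eqmodP/joined_discrete /= /finj cd.
    by rewrite -[c]reprK -[d]reprK; apply/eqmodP.
  have [x fx] := fsurj (repr d).
  exists (\pi_(pi0 R E) x) => //; rewrite -[RHS]reprK -fx /pi0_map.
  congr (\pi_(pi0 R Y) _); apply: joined_image.
  by have /eqmodP := reprK (\pi_(pi0 R E) x).
move=> n x0.
have hY (c d : homotopy_group R n.+1 (mkcts cf x0)) : c = d.
  by rewrite -[c]reprK -[d]reprK (cube_discrete_cst (repr c) (repr d)).
split; last by move=> c d; exact: hY.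
pose e : homotopy_group R n.+1 x0 := \pi_(homotopy_group R n.+1 x0)
  (mk_spheroid (@cst_continuous (cube R n.+1) E x0) (fun _ _ => erefl)).
by exists (fun=> e) => c; [exact: htriv|exact: hY].
Qed.

End DiscreteTarget.

(** * The map [exists_map] and path components *)

Section ExistsMap.
Context (R : realType) (X : topologicalType).
Hypothesis lpc : locally_path_connected R X.
Implicit Types (S T : Exp X) (x y : X).

Definition component_of x : components X :=
  SigSub (mem_set (imageT (connected_component [set: X]) x)).

(** Local path connectedness makes connected components path components, so membership becomes the
    existence of a path. *)
Lemma exists_mapP S x : reflect
  (exists2 s, s \in (S : {fset X}) & joined R s x)
  (\val (exists_map S) (component_of x)).
Proof.
rewrite /=; apply: (iffP (asboolP _)) => -[s sS].
  rewrite /= (connected_component_joined lpc)/= => xs; exists s => //.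
  by rewrite joined_sym.
move=> sx; exists s => //=.
by rewrite (connected_component_joined lpc)/= joined_sym.
Qed.

Lemma componentsP (i : components X) : exists x, i = component_of x.
Proof. by have /set_mem[x _ xi] := valP i; exists x; apply: val_inj. Qed.

Lemma exists_map_eqP S T : exists_map S = exists_map T <->
  forall x, \val (exists_map S) (component_of x) =
            \val (exists_map T) (component_of x).
Proof.
split=> [->//|h]; apply: val_inj; apply/funext => i.
by have [x ->] := componentsP i.
Qed.

Lemma exists_map_surj (g : direct_sum_I2 X) : exists S, exists_map S = g.
Proof.
have fin : finite_set [set i | \val g i] := set_mem (valP g).
have [r rE] := choice componentsP.
(* One point is taken from each component in the support of [g]. *)
exists (fset_set (r @` [set i | \val g i])).
have mem x : x \in (fset_set (r @` [set i | \val g i])) =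
    (x \in r @` [set i | \val g i]).
  by rewrite in_fset_set//; exact: finite_image.
apply: val_inj; apply/funext => i; apply/idP/idP.
  rewrite {1}(rE i) => /exists_mapP[s]; rewrite mem inE => -[k /= gk <-] kj.
  suff -> : i = k by [].
  rewrite (rE i) (rE k); apply: val_inj => /=.
  apply/esym/same_connected_component.
  by rewrite (connected_component_joined lpc).
move=> gi; rewrite (rE i); apply/exists_mapP; exists (r i).
  by rewrite mem inE; exists i.
exact: joined_refl.
Qed.

Lemma exists_map0 : exists_map (fset0 : {fset X}) = sum_zero X.
Proof.
apply: val_inj; apply/funext => i /=; apply/negbTE/negP => /asboolP[x].
by rewrite inE.
Qed.

Lemma exists_mapU S T :
  exists_map (S `|` T)%fset = sum_or (exists_map S) (exists_map T).
Proof.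
apply: val_inj; apply/funext => i /=; apply/asboolP/orP.
  by move=> [x]; rewrite inE => /orP[xS|xT] ix; [left|right]; apply/asboolP; exists x.
by move=> [|] /asboolP[x xS ix]; exists x; rewrite // inE xS ?orbT.
Qed.

(** * A criterion common to both topologies on Exp(X) *)

Section ExistsEquivalence.
Context (E : topologicalType) (op : E -> E -> E).
Hypothesis opA : associative op.
Hypothesis opC : commutative op.
Hypothesis opI : idempotent_op op.
Hypothesis op_continuous : forall (K : topologicalType) (F G : K -> E),
  compact [set: K] -> continuous F -> continuous G ->
  continuous (fun t => op (F t) (G t)).
(** In both applications [E] is Exp(X) with one of its topologies and [j] is the identity. *)
Variable j : Exp X -> E.
Hypothesis jU : forall S T, j (S `|` T)%fset = op (j S) (j T).
Hypothesis j_surj : forall z, exists S, j S = z.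
Hypothesis j1_continuous : continuous (fun x => j [fset x]%fset).

Lemma joined_op z x y : joined R x y ->
  joined R (op z (j [fset x]%fset)) (op z (j [fset y]%fset)).
Proof.
move=> /asboolP[p]; apply/asboolP.
have cq : continuous (fun s : unitI R => op z (j [fset p s]%fset)).
  apply: op_continuous; first exact: unitI_compact.
    exact: cst_continuous.
  move=> s; apply: (@continuous_comp _ _ _ p (fun x => j [fset x]%fset)).
    exact: cts_fun.
  exact: j1_continuous.
apply: inhabits.
by apply: (@mk_path _ _ _ _ _ cq); rewrite ?path_zero ?path_one.
Qed.

(** By induction the points of [T] are added one at a time, each starting as a second copy of a
    point of [S]. *)
Lemma joined_fsetU S T :
  (forall t, t \in (T : {fset X}) ->
     exists2 s, s \in (S : {fset X}) & joined R s t) ->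
  joined R (j S) (j (S `|` T)%fset).
Proof.
move=> h; elim/(@finSet_rect X): T h => T IH h.
have [->|[t tT]] := fset_0Vmem T.
  by rewrite fsetU0; exact: joined_refl.
have [s sS st] := h t tT.
have ST' : joined R (j S) (j (S `|` T `\ t)%fset).
  apply: IH; first exact: fproperD1.
  by move=> u; rewrite inE => /andP[_ /h].
apply: joined_trans ST' _.
have -> : (S `|` T = (S `|` T `\ t) `|` [fset t])%fset.
  by rewrite -{1}(fsetD1K tT) fsetUCA fsetUC.
have : s \in (S `|` T `\ t)%fset by rewrite inE sS.
move: (S `|` T `\ t)%fset => A sA.
(* As [s] is in [A], adding a copy of it changes nothing, and that copy can travel to [t]. *)
have {1}-> : A = (A `|` [fset s])%fset.
  apply/fsetP => u; rewrite !inE; case: (u =P s) => [->|_]; last by rewrite orbF.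
  by rewrite sA.
by rewrite !jU; apply: joined_op.
Qed.

Lemma exists_weak_equivalence (f : E -> direct_sum_I2 X) :
  continuous f -> (forall S, f (j S) = exists_map S) ->
  weak_homotopy_equivalence R f.
Proof.
move=> cf fj; apply: weak_equivalence_discrete => //.
- by move=> g; have [S Sg] := exists_map_surj g; exists (j S); rewrite fj.
- move=> z w; have [S <-] := j_surj z; have [T <-] := j_surj w.
  rewrite !fj => ST.
  (* Two sets meeting the same components are each joined to their union. *)
  have joinU A B : exists_map A = exists_map B -> joined R (j A) (j (A `|` B)%fset).
    move=> AB; apply: joined_fsetU => t tB.
    apply/exists_mapP; rewrite AB; apply/exists_mapP; exists t => //.
    exact: joined_refl.
  apply: joined_trans (joinU _ _ ST) _.
  by rewrite fsetUC joined_sym; apply: joinU.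
- by move=> n x0 c d; apply: (homotopy_group_trivial opA opC opI op_continuous).
Qed.

End ExistsEquivalence.
End ExistsMap.

(** * The metric exponential and its comparison with the topological one *)

Section Exponentials.
Context (X : topologicalType).
Implicit Types (S T : Exp X) (W : set (set X)).

Lemma filter_finite_bigcap (I : choiceType) (K : Type) (G : set_system K)
    (D : set I) (P : I -> set K) : Filter G ->
  finite_set D -> (forall i, D i -> G (P i)) -> G (\bigcap_(i in D) P i).
Proof.
move=> FG /finite_fsetP[A ->] h; exact: filter_bigI.
Qed.

Lemma nbhs_meeting_cover W S : finite_set W -> W `<=` open ->
  meeting_cover W S -> nbhs (S : ExpM X) (meeting_cover W).
Proof.
move=> finW oW WS; exists (meeting_cover W); split=> //.
exists [set meeting_cover W]; last by rewrite bigcup_set1.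
by move=> _ ->; apply: finI_from1; exists W.
Qed.

Lemma cvg_ExpM (G : set_system (ExpM X)) S : Filter G ->
  (forall W, finite_set W -> W `<=` open -> meeting_cover W S ->
     G (meeting_cover W)) ->
  G --> (S : ExpM X).
Proof.
move=> FG h A /= [_ [[B sB <-] [C BC CS] sBA]].
rewrite nbhs_filterE; apply: filterS sBA _; apply: (@filterS _ _ _ C).
  by move=> T CT; exists C.
have /sB[D sD DC] := BC; rewrite -DC; apply: filter_bigI => V VD.
have := sD _ VD; rewrite inE => -[W [finW oW] WV].
rewrite -WV; apply: h => //; rewrite WV.
by move: CS; rewrite -DC; apply.
Qed.

Lemma meeting_coverU W S T :
  meeting_cover W (S `|` T)%fset <->
  exists W1 W2, [/\ W = W1 `|` W2, meeting_cover W1 S & meeting_cover W2 T].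
Proof.
split=> [[cov meet]|[W1 [W2 [-> [cov1 meet1] [cov2 meet2]]]]]; last first.
  split=> [x /=|U].
    rewrite inE => /orP[xS|xT].
      by have [U ? ?] := cov1 _ xS; exists U => //; left.
    by have [U ? ?] := cov2 _ xT; exists U => //; right.
  move=> [/meet1|/meet2] [x [/= xS Ux]]; exists x; split => //=;
    by rewrite inE xS ?orbT.
(* [V A] collects the members of [W] that meet [A]; [V S] and [V T] may overlap. *)
pose V (A : Exp X) := W `&` [set U | [set` (A : {fset X})] `&` U !=set0].
have meetV (A : Exp X) : [set` (A : {fset X})] `<=` \bigcup_(U in W) U ->
    meeting_cover (V A) A.
  move=> h; split=> [x xA|U [//]].
  by have [U WU Ux] := h x xA; exists U => //; split => //; exists x.
exists (V S), (V T); split.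
- rewrite -setIUr; apply/esym/setIidPl => U /meet[x [/=]].
  by rewrite inE => /orP[xS|xT] Ux; [left|right]; exists x.
- by apply: meetV => x /= xS; apply: cov; rewrite /= inE xS.
- by apply: meetV => x /= xT; apply: cov; rewrite /= inE xT orbT.
Qed.

Lemma fsetU_ExpM_continuous (K : topologicalType) (F G : K -> ExpM X) :
  continuous F -> continuous G ->
  continuous (fun t => (F t `|` G t)%fset : ExpM X).
Proof.
move=> cF cG t; apply: cvg_ExpM => W finW oW.
move=> /meeting_coverU[W1 [W2 [WE m1 m2]]].
have sub1 : W1 `<=` W by rewrite WE; exact: subsetUl.
have sub2 : W2 `<=` W by rewrite WE; exact: subsetUr.
have n1 : nbhs t (F @^-1` meeting_cover W1).
  apply: cF; apply: nbhs_meeting_cover => //; first exact: sub_finite_set finW.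
  exact: subset_trans oW.
have n2 : nbhs t (G @^-1` meeting_cover W2).
  apply: cG; apply: nbhs_meeting_cover => //; first exact: sub_finite_set finW.
  exact: subset_trans oW.
apply: filterS2 n1 n2 => s s1 s2; apply/meeting_coverU.
by exists W1, W2.
Qed.

Lemma fset1_ExpM_continuous : continuous (fun x => [fset x]%fset : ExpM X).
Proof.
move=> x; apply: cvg_ExpM => W finW oW [cov meet].
(* The covering condition makes [W] nonempty, and [U0] will cover the nearby singletons. *)
have [U0 WU0 _] : (\bigcup_(U in W) U) x by apply: cov; rewrite /= inE.
have : nbhs x (\bigcap_(U in W) U).
  apply: filter_finite_bigcap => // U WU; apply: open_nbhs_nbhs.
  split; first exact: oW.
  by have [y [/=]] := meet U WU; rewrite inE => /eqP ->.
apply: filterS => y yW; split=> [z /=|U WU].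
  by rewrite inE => /eqP ->; exists U0 => //; exact: yW.
by exists y; split; [rewrite /= inE|exact: yW].
Qed.

Lemma tuple_setP n (x : {ptws 'I_n -> X}) y :
  reflect (exists i, x i = y) (y \in (tuple_set x : {fset X})).
Proof.
rewrite /tuple_set; apply: (iffP (imfsetP _ _ _ _)) => [[i _ ->]|[i <-]];
  by exists i.
Qed.

Lemma open_forall_tuple n (U : 'I_n -> set X) : (forall i, open (U i)) ->
  open [set x : {ptws 'I_n -> X} | forall i, U i (x i)].
Proof.
move=> oU; rewrite openE => x xU; rewrite /interior.
apply: (@filter_forall _ _
  (fun i => [set y : {ptws 'I_n -> X} | U i (y i)]) (nbhs x)) => i.
apply: (@proj_continuous _ (fun=> X) i x); apply: open_nbhs_nbhs; split=> //.
Qed.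

Lemma open_exists_tuple n (U : set X) : open U ->
  open [set x : {ptws 'I_n -> X} | exists i, U (x i)].
Proof.
move=> oU; rewrite openE => x [i Ui]; rewrite /interior.
apply: (@filterS _ _ _ [set y : {ptws 'I_n -> X} | U (y i)]).
  by move=> y Uy; exists i.
by apply: (@proj_continuous _ (fun=> X) i x); exact: open_nbhs_nbhs.
Qed.

Lemma open_ExpTE (V : set (ExpT X)) : open V = expT_open V.
Proof. by []. Qed.

Definition expTM (S : ExpT X) : ExpM X := S.

Lemma expTM_continuous : continuous expTM.
Proof.
move=> S.
have FS : Filter (expTM @ nbhs S) by apply: fmap_filter; exact: nbhs_filter.
apply: (cvg_ExpM FS) => W finW oW WS; apply: open_nbhs_nbhs; split; last exact: WS.
rewrite open_ExpTE => n; rewrite /expTM.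
(* On tuples, covering is an open condition on every entry, and meeting each member of [W] is a
   finite intersection of open conditions. *)
have -> : @tuple_set X n @^-1` meeting_cover W =
    [set x : {ptws 'I_n -> X} | forall i, (\bigcup_(U in W) U) (x i)] `&`
    \bigcap_(U in W) [set x : {ptws 'I_n -> X} | exists i, U (x i)].
  apply/seteqP; split=> x /= [cov meet]; split.
  - by move=> i; apply: cov; apply/tuple_setP; exists i.
  - by move=> U /meet[y [/= /tuple_setP[i <-] Uy]]; exists i.
  - by move=> y /tuple_setP[i <-].
  - move=> U /meet[i Ui]; exists (x i); split=> //=.
    by apply/tuple_setP; exists i.
apply: openI.
  by apply: (@open_forall_tuple n (fun=> \bigcup_(U in W) U)) => _;
     apply: bigcup_open => U /oW.
rewrite openE => x xW; apply: filter_finite_bigcap => // U WU.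
apply: open_nbhs_nbhs; split; last exact: xW.
by apply: open_exists_tuple; exact: oW.
Qed.
End Exponentials.

(** * Bounded cardinality and compact families in the Hausdorff case *)

Section HausdorffExponential.
Context (X : topologicalType).
Hypothesis hX : hausdorff_space X.
Implicit Types (S T : Exp X).

(** Boxes are a filter basis whose filter converges in each coordinate, hence in the product. *)
Lemma nbhs_tuple_box n (x : {ptws 'I_n -> X}) (A : set {ptws 'I_n -> X}) :
  nbhs x A -> exists2 B : 'I_n -> set X, (forall i, nbhs (x i) (B i)) &
    forall y : {ptws 'I_n -> X}, (forall i, B i (y i)) -> A y.
Proof.
pose box (B : 'I_n -> set X) := [set y : {ptws 'I_n -> X} | forall i, B i (y i)].
pose G := filter_from [set B : 'I_n -> set X | forall i, nbhs (x i) (B i)] box.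
have FG : Filter G.
  apply: filter_from_filter; first by exists (fun=> setT) => i; exact: filterT.
  move=> B C xB xC; exists (fun i => B i `&` C i).
    by move=> i; apply: filterI; [exact: xB|exact: xC].
  by move=> y h; split=> i; have [] := h i.
suff cG : G --> x by move=> /cG[B xB BA]; exists B.
apply/cvg_sup => i C.
rewrite nbhsE => -[_ [[D oD <-] Dx] DC].
exists (fun k => if k == i then D else setT).
  move=> k; case: eqP => [->|_]; last exact: filterT.
  exact: open_nbhs_nbhs.
by move=> y /(_ i); rewrite eqxx => Dy; apply: DC.
Qed.

Lemma hausdorff_disjoint_nbhs (x y : X) : x <> y ->
  exists AB : set X * set X,
    [/\ nbhs x AB.1, nbhs y AB.2 & AB.1 `&` AB.2 = set0].
Proof.
move=> /eqP xy; have := hX; rewrite open_hausdorff => /(_ _ _ xy).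
move=> [[A B] /= [/set_mem xA /set_mem yB] [oA oB /eqP AB]].
by exists (A, B); split=> //; apply: open_nbhs_nbhs.
Qed.

(** This compares the two topologies on sets of at most [n] points. Each point of [S] gets a small
    open set, disjoint from the others and contained in the boxes of the finitely many [n]-tuples in
    [S]. Listing [T] as an [n]-tuple and replacing entries by the centres of their open sets gives a
    listing of [S], whose box contains that of [T]. *)
Lemma ExpT_vietoris_nbhs n (V : set (ExpT X)) S : open V -> V S ->
  exists W, [/\ finite_set W, W `<=` open, meeting_cover W S &
    forall T, meeting_cover W T -> (#|` (T : {fset X})| <= n)%N -> V T].
Proof.
rewrite open_ExpTE => /(_ n) oV VS.
pose fS := (S : {fset X}).
(* Only tuples [f] that exhaust [S] lie over [S]; for the others any box will do. *)
pose good (f : {ffun 'I_n -> fS}) (C : 'I_n -> set X) :=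
  (forall i, nbhs (val (f i)) (C i)) /\
  (@tuple_set X n (fun i => val (f i)) = S ->
   forall y : {ptws 'I_n -> X}, (forall i, C i (y i)) -> V (tuple_set y)).
have [B nB] : {B : {ffun 'I_n -> fS} -> 'I_n -> set X &
    forall f, good f (B f)}.
  apply: choice.
  move=> f; have [fE|nfE] := pselect (@tuple_set X n (fun i => val (f i)) = S).
    have [|C nC CV] := @nbhs_tuple_box n (fun i => val (f i)) (@tuple_set X n @^-1` V).
      by apply: open_nbhs_nbhs; split=> //=; rewrite fE.
    by exists C.
  by exists (fun=> setT); split=> // i; exact: filterT.
have [P nP] : {P : X * X -> set X * set X & forall xy, xy.1 <> xy.2 ->
    [/\ nbhs xy.1 (P xy).1, nbhs xy.2 (P xy).2 & (P xy).1 `&` (P xy).2 = set0]}.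
  apply: (@choice _ _ (fun xy (AB : set X * set X) => xy.1 <> xy.2 ->
    [/\ nbhs xy.1 AB.1, nbhs xy.2 AB.2 & AB.1 `&` AB.2 = set0])).
  move=> [x y]; have [->|/eqP xy] := eqVneq x y; first by exists (setT, setT).
  by have [AB] := hausdorff_disjoint_nbhs xy; exists AB.
(* [P] need not be symmetric in its pair, so both orders are imposed. *)
pose U (s : fS) :=
  [set y : X | forall (f : {ffun 'I_n -> fS}) i, f i = s -> B f i y] `&`
  [set y | forall s' : fS, s <> s' ->
     (P (val s, val s')).1 y /\ (P (val s', val s)).2 y].
have nU s : nbhs (val s) (U s).
  apply: filterI.
    apply: filter_forall => f; apply: filter_forall => i.
    have [<-|fs] := eqVneq (f i) s.
      by have [nBf _] := nB f; apply: filterS (nBf i).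
    by apply: filterS filterT => y _ fis; rewrite fis eqxx in fs.
  apply: filter_forall => s'; have [->|/eqP ss'] := eqVneq s s'.
    exact: filterS filterT.
  have vss' : val s <> val s' by move=> /val_inj.
  have [n1 _ _] := nP (val s, val s') vss'.
  have [_ n2 _] := nP (val s', val s) (nesym vss').
  by apply: filterS2 n1 n2.
have Uinj s s' y : U s y -> U s' y -> s = s'.
  move=> [_ h] [_ h']; apply/eqP/negPn/negP => /eqP ss'.
  have [h1 _] := h s' ss'; have [_ h2] := h' s (nesym ss').
  have vss' : val s <> val s' by move=> /val_inj.
  by have [_ _ /seteqP[/(_ y) h0 _]] := nP (val s, val s') vss'; apply: h0.
exists (range (fun s => (U s)°)); split.
- exact/finite_image/finite_finset.
- by move=> _ [s _ <-]; exact: open_interior.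
- split=> [x xS|_ [s _ <-]].
    by exists (U [` xS]%fset)°; [exists [` xS]%fset|exact: (nU [` xS]%fset)].
  by exists (val s); split; [exact: valP|exact: (nU s)].
move=> T [cov meet] Tn.
(* For empty [S] there are no open sets, and covering forces [T] to be empty; otherwise [T] has a
   point. *)
have [S0|[s0 s0S]] := fset_0Vmem fS.
  suff -> : T = S by [].
  rewrite -[S]/fS S0; apply/fsetP => x; rewrite inE; apply/negbTE/negP => xT.
  have [_ [s _ _] _] := cov x xT.
  by have /fsetP/(_ (val s)) := S0; rewrite (valP s) inE.
have [t0 [/= t0T _]] := meet _ (imageT (fun s => (U s)°) [` s0S]%fset).
(* The default [t0] is in [T], so padding up to length [n] adds no new point. *)
pose y : {ptws 'I_n -> X} := fun i => nth t0 (enum_fset T) i.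
have yE t : t \in (T : {fset X}) -> exists i, y i = t.
  move=> tT; have it : (index t (enum_fset T) < n)%N.
    by apply: leq_trans Tn; rewrite index_mem.
  by exists (Ordinal it); rewrite /y /= nth_index.
have yT i : y i \in (T : {fset X}).
  rewrite /y; have [iT|iT] := ltnP i (size (enum_fset T)); first exact: mem_nth.
  by rewrite nth_default.
have tyE : tuple_set y = T.
  apply/fsetP => t; apply/tuple_setP/idP; last exact: yE.
  by move=> [i <-].
have [g gU] : {g : 'I_n -> fS & forall i, U (g i) (y i)}.
  apply: (@choice _ _ (fun i s => U s (y i))) => i.
  have [_ [s _ <-] /interior_subset sy] := cov _ (yT i).
  by exists s.
pose f := [ffun i => g i].
rewrite -tyE; apply: (nB f).2.
  (* [f] exhausts [S]: every open set is met by [T], and disjointness identifies its centre. *)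
  apply/fsetP => s; apply/tuple_setP/idP => [[i <-]|sS]; first exact: valP.
  have [t [/= tT /interior_subset st]] :=
    meet _ (imageT (fun s => (U s)°) [` sS]%fset).
  have [i yi] := yE _ tT; exists i; rewrite ffunE.
  by rewrite (Uinj (g i) [` sS]%fset (y i))// yi.
by move=> i; have [h _] := gU i; apply: h; rewrite ffunE.
Qed.

Lemma bounded_ExpT_continuous n (K : topologicalType) (F : K -> Exp X) :
  (forall t, (#|` (F t : {fset X})| <= n)%N) ->
  continuous (F : K -> ExpM X) -> continuous (F : K -> ExpT X).
Proof.
move=> Fn cF t A /=; rewrite nbhsE => -[V [oV Vt] VA].
have [W [finW oW WFt WV]] := ExpT_vietoris_nbhs n oV Vt.
have : nbhs t ((F : K -> ExpM X) @^-1` meeting_cover W).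
  by apply: cF; exact: nbhs_meeting_cover.
by apply: filterS => s Ws; apply: VA; apply: WV.
Qed.

(** A tuple fails to enumerate [S] exactly when an entry leaves [S] or a point of [S] is missed;
    both are open because finite sets are closed. *)
Lemma open_tuple_neq n S : open [set x : {ptws 'I_n -> X} | tuple_set x <> S].
Proof.
have fin_closed := (accessible_finite_set_closed.1 (hausdorff_accessible hX)).
pose fS := (S : {fset X}).
have -> : [set x : {ptws 'I_n -> X} | tuple_set x <> S] =
    [set x | exists i, (~` [set` fS]) (x i)] `|`
    \bigcup_(s in [set` fS]) [set x | forall i, (~` [set s]) (x i)].
  apply/seteqP; split=> x /=.
    move=> xS; apply: contrapT => /not_orP[h1 h2]; apply: xS.
    apply/fsetP => s; apply/tuple_setP/idP => [[i <-]|sS].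
      by apply: contrapT => h; apply: h1; exists i.
    by apply: contrapT => h; apply: h2; exists s => // i /= xi; apply: h; exists i.
  move=> h xS; case: h => [[i]|[s sS h]].
    by apply; rewrite /= /fS -xS; apply/tuple_setP; exists i.
  have /tuple_setP[i xi] : s \in (tuple_set x : {fset X}) by rewrite xS.
  exact: (h i).
apply: openU.
  apply: open_exists_tuple; rewrite openC; apply: fin_closed; exact: finite_fset.
apply: bigcup_open => s _; apply: (@open_forall_tuple _ n (fun=> ~` [set s])) => _.
by rewrite openC; apply: fin_closed; exact: finite_set1.
Qed.

Lemma card_tuple_set n (x : {ptws 'I_n -> X}) :
  (#|` (tuple_set x : {fset X})| <= n)%N.
Proof. by apply: leq_trans (leq_imfset_card _ _ _) _; rewrite -cardE card_ord. Qed.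

(** If [F (t n)] has more than [n] points, the sets [C n] avoiding the tail from [n] on are open,
    increase with [n] and cover the image. By compactness some [C N] contains the whole image,
    including the excluded [F (t N)]. *)
Lemma compact_ExpT_bounded (K : topologicalType) (F : K -> ExpT X) :
  compact [set: K] -> continuous F ->
  exists n, forall t, (#|` (F t : {fset X})| <= n)%N.
Proof.
move=> cK cF; apply: contrapT => nb.
have [t tn] : {t : nat -> K & forall n, (n < #|` (F (t n) : {fset X})|)%N}.
  apply: (@choice _ _ (fun n t => (n < #|` (F t : {fset X})|)%N)) => n.
  apply: contrapT => h; apply: nb; exists n => t.
  by rewrite leqNgt; apply/negP => tn; apply: h; exists t.
pose C n : set (ExpT X) := [set S | forall m, (n <= m)%N -> S <> F (t m)].
have oC n : open (C n).
  rewrite open_ExpTE => k.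
  (* A [k]-tuple has at most [k] points and [F (t m)] more than [m], so only the finitely many
     indices below [k] impose a condition. *)
  rewrite (_ : _ @^-1` _ = [set x : {ptws 'I_k -> X} | forall i : 'I_k,
      (n <= i)%N -> tuple_set x <> F (t i)]); last first.
    apply/seteqP; split=> x /= h m nm; first exact: h.
    have [mk|km] := ltnP m k; first exact: (h (Ordinal mk)).
    move=> xm; have := tn m; rewrite -xm ltnNge => /negP; apply.
    exact: leq_trans (card_tuple_set x) km.
  rewrite openE => x xC; rewrite /interior.
  apply: (@filter_forall _ _ (fun i : 'I_k => [set x : {ptws 'I_k -> X} |
    (n <= i)%N -> tuple_set x <> F (t i)]) (nbhs x)) => i.
  have [ni|ni] := boolP (n <= i)%N; last first.
    by apply: filterS filterT => y _ /= ni'; case/negP: ni.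
  have : nbhs x [set x : {ptws 'I_k -> X} | tuple_set x <> F (t i)].
    by apply: open_nbhs_nbhs; split; [exact: open_tuple_neq|exact: xC].
  by apply: filterS => y yF _.
have /compact_near_coveringP/(_ nat \oo (fun n s => C n (F s))) := cK.
case=> [s _|N _ /(_ N (leqnn N) (t N) I)]; last by move=> /(_ N (leqnn N)).
pose k := #|` (F s : {fset X})|.
have Cs : C k (F s).
  by move=> m km sm; have := tn m; rewrite -sm ltnNge km.
exists (F @^-1` C k, [set n | (k <= n)%N]).
  split; last exact: nbhs_infty_ge.
  by apply: cF; apply: open_nbhs_nbhs; split=> //; exact: oC.
by move=> [s' n] [/= Cs' kn] m nm; apply: Cs'; exact: leq_trans nm.
Qed.

(** Compactness bounds both cardinalities, hence that of the union, and for bounded families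
    continuity may be checked in Exp_M(X). *)
Lemma fsetU_ExpT_continuous (K : topologicalType) (F G : K -> ExpT X) :
  compact [set: K] -> continuous F -> continuous G ->
  continuous (fun t => (F t `|` G t)%fset : ExpT X).
Proof.
move=> cK cF cG.
have [n Fn] := compact_ExpT_bounded cK cF.
have [m Gm] := compact_ExpT_bounded cK cG.
apply: (@bounded_ExpT_continuous (n + m)) => [t|].
  by rewrite (leq_trans _ (leq_add (Fn t) (Gm t)))// cardfsU leq_subr.
have cM (H : K -> ExpT X) : continuous H -> continuous (fun t => expTM (H t)).
  by move=> cH t; apply: continuous_comp; [exact: cH|exact: expTM_continuous].
by apply: (@fsetU_ExpM_continuous _ _ (fun t => expTM (F t))); exact: cM.
Qed.

Lemma fset1_ExpT_continuous : continuous (fun x => [fset x]%fset : ExpT X).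
Proof.
apply: (@bounded_ExpT_continuous 1); last exact: fset1_ExpM_continuous.
by move=> x; rewrite cardfs1.
Qed.

End HausdorffExponential.

(** * Continuity of the map to components *)

Lemma open_joined (R : realType) (X : topologicalType) (x : X) :
  locally_path_connected R X -> open [set y | joined R x y].
Proof.
move=> lpc; rewrite openE => y xy.
have [V [[oV Vy] _ pV]] := lpc y setT filterT.
apply: (@filterS _ _ _ V); last exact: open_nbhs_nbhs.
move=> z Vz /=; apply: joined_trans xy _.
by have [p _] := pV y z Vy Vz; apply/asboolP; exact: (inhabits p).
Qed.

Lemma exists_M_continuous (R : realType) (X : topologicalType) :
  locally_path_connected R X -> continuous (@exists_M X).
Proof.
move=> lpc S A /nbhs_singleton AS.
(* [W] consists of the path components meeting [S]. A set in [meeting_cover W] meets exactly these,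
   so [exists_M] is constant near [S]. *)
pose W := (fun x => [set y | joined R x y]) @` [set` (S : {fset X})].
have : nbhs (S : ExpM X) (meeting_cover W).
  apply: nbhs_meeting_cover; first exact/finite_image/finite_fset.
    by move=> _ [x _ <-]; exact: open_joined.
  split=> [x xS|_ [x xS <-]].
    by exists [set y | joined R x y]; [exists x|exact: joined_refl].
  by exists x; split=> //; exact: joined_refl.
have FS : Filter (nbhs (S : ExpM X)) by exact: nbhs_filter.
apply: filterS => T [cov meet]; rewrite /preimage /=.
suff -> : exists_M T = exists_M S by [].
apply/exists_map_eqP => x; apply/(exists_mapP lpc)/(exists_mapP lpc) => -[s sS sx].
  have [_ [t tS <-] /= ts] := cov s sS.
  by exists t => //; exact: joined_trans sx.
have [|t [/= tT st]] := meet [set y | joined R s y]; first by exists s.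
by exists t => //; apply: joined_trans sx; rewrite joined_sym.
Qed.

Lemma exists_T_continuous (R : realType) (X : topologicalType) :
  locally_path_connected R X -> continuous (@exists_T X).
Proof.
move=> lpc S; apply: (@continuous_comp _ _ _ (@expTM X) (@exists_M X)).
  exact: expTM_continuous.
exact: (exists_M_continuous lpc).
Qed.

End HomotopyOfExponentials.

Theorem theorem2p24 (R : realType) (X : topologicalType)
    (X_lpc : locally_path_connected R X) :
  [/\ monoid_morphism (@exists_M X),
      continuous (@exists_M X),
      weak_homotopy_equivalence R (@exists_M X)
    & hausdorff_space X ->
      continuous (@exists_T X) /\ weak_homotopy_equivalence R (@exists_T X)].
Proof.
split; last (move=> hX; split).
- by split; [exact: exists_map0|exact: exists_mapU].
- exact: exists_M_continuous X_lpc.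
- apply: (@exists_weak_equivalence R X X_lpc (ExpM X) (fun S T => (S `|` T)%fset)
    (@fsetUA X) (@fsetUC X) (@fsetUid X) _ id) => //.
  + by move=> K F G _; exact: fsetU_ExpM_continuous.
  + by move=> S; exists S.
  + exact: fset1_ExpM_continuous.
  + exact: exists_M_continuous X_lpc.
- exact: exists_T_continuous X_lpc.
- apply: (@exists_weak_equivalence R X X_lpc (ExpT X) (fun S T => (S `|` T)%fset)
    (@fsetUA X) (@fsetUC X) (@fsetUid X) _ id) => //.
  + by move=> K F G; exact: fsetU_ExpT_continuous.
  + by move=> S; exists S.
  + exact: fset1_ExpT_continuous.
  + exact: exists_T_continuous X_lpc.
Qed.
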